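(* Let $d$ be a positive integer. For integers $0\le k\le n$, $$\frac{\det\left(\binom{n+i+j}{k+j}_{F(s,t)}\right)_{i,j=0}^{d-1}}{\det\left(\binom{n+i+j}{j}_{F(s,t)}\right)_{i,j=0}^{d-1}}=\left\langle \begin{matrix} n\\ k\end{matrix}\right\rangle_{d,F(s,t)},$$ and for integers $n,k\ge0$, $$\frac{\det\left(\binom{n+i+k}{k+j}_{F(s,t)}\right)_{i,j=0}^{d-1}}{\det\left(\binom{n+i}{j}_{F(s,t)}\right)_{i,j=0}^{d-1}}=\left\langle \begin{matrix} n+k\\ k\end{matrix}\right\rangle_{d,F(s,t)},$$ as identities of rational functions in $s,t$.
   Context: $s,t$ are indeterminates. Fibonacci polynomials: $F_0(s,t)=0$, $F_1(s,t)=1$, $F_n(s,t)=sF_{n-1}(s,t)+tF_{n-2}(s,t)$. Fibonomials: $\binom{m}{k}_{F(s,t)}=\prod_{j=0}^{k-1}\frac{F_{m-j}(s,t)}{F_{k-j}(s,t)}$ for $0\le k\le m$, and $0$ if $k<0$ or $k>m$. Hoggatt coefficients: for $0\le k\le n$, $\left\langle \begin{matrix} n\\ k\end{matrix}\right\rangle_{d,F(s,t)}=\prod_{j=0}^{k-1}\frac{\binom{n-j+d-1}{d}_{F(s,t)}}{\binom{k-j+d-1}{d}_{F(s,t)}}$. *)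

(* Defs.v *)
From HB Require Import structures.
From mathcomp Require Import all_boot all_order all_algebra.
From mathcomp Require Import mpoly.

Set Implicit Arguments.
Unset Strict Implicit.
Unset Printing Implicit Defensive.

Import GRing.Theory.
Local Open Scope ring_scope.

Definition ratfun : fieldType := {fraction {mpoly rat[2]}}.

Definition var_s : {mpoly rat[2]} := 'X_(0 : 'I_2).
Definition var_t : {mpoly rat[2]} := 'X_(1 : 'I_2).

Fixpoint fib_poly (n : nat) : {mpoly rat[2]} :=
  match n with
  | 0 => 0
  | m.+1 =>
      match m with
      | 0 => 1
      | p.+1 => var_s * fib_poly m + var_t * fib_poly p
      end
  end.

Definition fib (n : nat) : ratfun := tofrac (fib_poly n).

(* The lower index is a natural number, so the convention that the fibonomial
   vanishes for a negative lower index has nothing to apply to. *)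
Definition fibonomial (m k : nat) : ratfun :=
  if (k <= m)%N then \prod_(0 <= j < k) (fib (m - j) / fib (k - j)) else 0.

(* Meaningful for 0 < d and k <= n only: every subtraction below is then an
   honest one, as j < k <= n. *)
Definition hoggatt (d n k : nat) : ratfun :=
  \prod_(0 <= j < k)
    (fibonomial (n - j + d - 1) d / fibonomial (k - j + d - 1) d).

(* Main.v *)
(** Every fibonomial matrix in the theorem is a two-sided diagonal rescaling of
    the matrix in the corresponding denominator, since fibonomials are quotients
    of Fibonacci factorials; the product of the scaling factors is the Hoggatt
    coefficient.  The denominators do not vanish because under [s = 2], [t = -1]
    we get [F_n = n], so that they specialise to determinants of the form
    [det ('C(a_j + i, j))], which equal [1]: by Vandermonde's convolution such a
    matrix is the product of a lower and an upper unitriangular one. *)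
Require Import Defs.
From HB Require Import structures.
From mathcomp Require Import all_boot all_order all_algebra.
From mathcomp Require Import mpoly zify ring.

Set Implicit Arguments.
Unset Strict Implicit.
Unset Printing Implicit Defensive.

Import GRing.Theory Num.Theory.
Local Open Scope ring_scope.

Lemma det_scale (R : comNzRingType) (d : nat) (r c : 'I_d -> R)
    (f : 'I_d -> 'I_d -> R) :
  \det (\matrix_(i, j) (r i * c j * f i j)) =
  (\prod_i r i) * (\prod_j c j) * \det (\matrix_(i, j) f i j).
Proof.
have -> : \matrix_(i, j) (r i * c j * f i j) =
    diag_mx (\row_i r i) *m (\matrix_(i, j) f i j) *m diag_mx (\row_j c j).
  by apply/matrixP=> i j; rewrite mul_mx_diag mul_diag_mx !mxE mulrAC.
rewrite !det_mulmx !det_diag mulrAC.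
by congr (_ * _ * _); apply: eq_bigr => i _; rewrite mxE.
Qed.

Lemma det_binomial (R : comNzRingType) (d : nat) (a : nat -> nat) :
  \det (\matrix_(i < d, j < d) ('C(a j + i, j))%:R) = 1 :> R.
Proof.
pose L : 'M[R]_d := \matrix_(i < d, l < d) ('C(i, l))%:R.
(* The guard makes [U] upper triangular: for [l > j] the truncated [j - l] is [0], and the binomial
   would be [1]. *)
pose U : 'M[R]_d :=
  \matrix_(l < d, j < d) (if (l <= j)%N then 'C(a j, j - l) else 0%N)%:R.
have -> : \matrix_(i < d, j < d) ('C(a j + i, j))%:R = L *m U.
  apply/matrixP=> i j; rewrite !mxE addnC -binomial.Vandermonde natr_sum.
  rewrite (big_ord_widen d (fun l => ('C(i, l) * 'C(a j, j - l))%:R)) ?ltn_ord //.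
  rewrite big_mkcond; apply: eq_bigr => l _.
  by rewrite !mxE ltnS; case: leqP => _; rewrite ?mulr0 // natrM.
rewrite det_mulmx det_trig; last first.
  by apply/is_trig_mxP=> i j lt_ij; rewrite mxE bin_small.
rewrite -[\det U]det_tr det_trig; last first.
  by apply/is_trig_mxP=> i j lt_ij; rewrite !mxE leqNgt lt_ij.
by rewrite !big1 ?mulr1 // => i _; rewrite !mxE ?binn // leqnn subnn bin0.
Qed.

Definition at_2_N1 (i : 'I_2) : rat := if i == 0 then 2%:R else -1.

Lemma meval_fib_poly (n : nat) : (fib_poly n).@[at_2_N1] = n%:R.
Proof.
suff [] : (fib_poly n).@[at_2_N1] = n%:R /\ (fib_poly n.+1).@[at_2_N1] = n.+1%:R by [].
elim: n => [|n [IH0 IH1]]; first by split; rewrite ?meval0 ?meval1.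
split=> //; rewrite [fib_poly n.+2]/= mevalD !mevalM IH1.
rewrite -/(fib_poly n) IH0 !mevalXU /at_2_N1 /= mulN1r mulr_natl.
by rewrite mulr2n -addrA -natrB // subSnn natr1.
Qed.

Lemma fib_neq0 (n : nat) : (0 < n)%N -> fib n != 0.
Proof.
move=> n_gt0; rewrite /fib tofrac_eq0; apply/eqP=> /(congr1 (meval at_2_N1)) /eqP.
by rewrite meval_fib_poly meval0 pnatr_eq0 eqn0Ngt n_gt0.
Qed.

Definition fib_fact (n : nat) : ratfun := \prod_(0 <= l < n) fib l.+1.

Lemma fib_fact_neq0 (n : nat) : fib_fact n != 0.
Proof. by rewrite /fib_fact big_mkord; apply/prodf_neq0 => l _; apply: fib_neq0. Qed.

Lemma fib_fact_rev (n : nat) : \prod_(0 <= l < n) fib (n - l) = fib_fact n.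
Proof.
rewrite /fib_fact big_nat_rev /=; apply: eq_big_nat => l /andP[_ lt_ln].
by rewrite add0n subKn.
Qed.

(* For [m < k] the truncated subtraction reaches [fib 0 = 0], so the left-hand
   product vanishes just as [fibonomial m k] does. *)
Lemma fib_ffactE (m k : nat) :
  \prod_(0 <= l < k) fib (m - l) = fibonomial m k * fib_fact k.
Proof.
rewrite /fibonomial; case: leqP => [le_km | lt_mk].
  by rewrite big_split /= prodfV fib_fact_rev divfK ?fib_fact_neq0.
by rewrite (big_cat_nat _ (n := m)) ?(ltnW lt_mk) //= [X in _ * X]big_ltn // subnn
  /fib tofrac0 mul0r mulr0 mul0r.
Qed.

Lemma fib_ffact (m k : nat) : (k <= m)%N ->
  \prod_(0 <= l < k) fib (m - l) = fib_fact m / fib_fact (m - k).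
Proof.
move=> le_km; rewrite -(fib_fact_rev m) (big_cat_nat _ (n := k) (p := m)) //=.
suff -> : \prod_(k <= l < m) fib (m - l) = fib_fact (m - k).
  by rewrite mulfK ?fib_fact_neq0.
rewrite -{1}[k]add0n big_addn -fib_fact_rev.
by apply: eq_bigr => l _; rewrite addnC subnDA.
Qed.

Lemma fibonomialE (m k : nat) : (k <= m)%N ->
  fibonomial m k = fib_fact m / fib_fact k / fib_fact (m - k).
Proof.
move=> le_km; apply: (mulIf (fib_fact_neq0 k)).
by rewrite -fib_ffactE fib_ffact // mulrAC divfK ?fib_fact_neq0.
Qed.

(** The first [k] factors of the falling product for [m + k] give the factorial quotient; the rest
    is the falling product for [m]. For [j > m] both sides vanish, a case that occurs in the second
    identity. *)
Lemma fibonomial_add (m k j : nat) :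
  fibonomial (m + k) (k + j) =
  fib_fact (m + k) / fib_fact m * (fib_fact j / fib_fact (k + j)) *
  fibonomial m j.
Proof.
apply: (mulIf (fib_fact_neq0 (k + j))).
rewrite -fib_ffactE (big_cat_nat _ (n := k)) ?leq_addr //=.
rewrite fib_ffact ?leq_addl // addnK -{2}[k]add0n big_addn addKn.
under [X in _ * X]eq_bigr => l _ do rewrite subnDr.
rewrite fib_ffactE -!mulrA [fibonomial m j * fib_fact (k + j)]mulrC.
by rewrite mulKf ?fib_fact_neq0 // [fibonomial m j * _]mulrC.
Qed.

(** The form needed by [det_scale]: the first product collects the row factors, the second the
    column factors. *)
Lemma hoggattE (d n k : nat) : (0 < d)%N -> (k <= n)%N ->
  hoggatt d n k = (\prod_(i < d) (fib_fact (n + i) / fib_fact (n - k + i))) *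
                  (\prod_(i < d) (fib_fact i / fib_fact (k + i))).
Proof.
move=> d_gt0 le_kn.
have fibonomial_rising m : (0 < m)%N ->
    fibonomial (m + d - 1) d = (\prod_(i < d) fib (m + i)) / fib_fact d.
  move=> m_gt0; apply: (mulIf (fib_fact_neq0 d)).
  rewrite divfK ?fib_fact_neq0 // -fib_ffactE big_nat_rev big_mkord.
  by apply: eq_bigr => i _; congr fib; have := ltn_ord i; lia.
have -> : hoggatt d n k =
    \prod_(0 <= j < k) \prod_(i < d) (fib (n + i - j) / fib (k + i - j)).
  apply: eq_big_nat => j /andP[_ lt_jk].
  rewrite !fibonomial_rising ?subn_gt0 //; last exact: leq_trans le_kn.
  rewrite -mulf_div divff ?mulr1; last by rewrite invr_eq0 fib_fact_neq0.
  rewrite -prodf_div; apply: eq_bigr => i _.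
  by rewrite !addnBAC // ltnW // (leq_trans lt_jk).
(* For fixed [i], the product over [j] is a quotient of two falling products of length [k]. *)
rewrite exchange_big -big_split; apply: eq_bigr => i _ /=.
rewrite prodf_div !fib_ffact ?leq_addr ?(leq_trans le_kn) ?leq_addr //.
by rewrite addKn addnBAC // invf_div.
Qed.

(** Multiplying column [j] by [fib_fact j] clears denominators, so the matrix can be specialised.
    The two denominators of the theorem are [a j = n + j] and [a j = n]. *)
Lemma det_fibonomial_neq0 (d : nat) (a : nat -> nat) :
  \det (\matrix_(i < d, j < d) fibonomial (a j + i) j) != 0.
Proof.
pose P : 'M[{mpoly rat[2]}]_d :=
  \matrix_(i, j) \prod_(0 <= l < j) fib_poly (a j + i - l).
suff detP_neq0 : \det P != 0.
  have := detP_neq0; rewrite -tofrac_eq0 -det_map_mx.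
  have -> : map_mx (@tofrac _) P =
      \matrix_(i, j) (1 * fib_fact j * fibonomial (a j + i) j).
    by apply/matrixP=> i j; rewrite !mxE rmorph_prod mul1r mulrC -fib_ffactE.
  by rewrite det_scale mulf_eq0 negb_or => /andP[].
suff : \det (map_mx (meval at_2_N1) P) != 0.
  by apply: contraNneq => P0; rewrite det_map_mx P0 rmorph0.
(* The falling products specialise to ordinary falling factorials. *)
have -> : map_mx (meval at_2_N1) P =
    \matrix_(i, j) (1 * (j`!)%:R * ('C(a j + i, j))%:R).
  apply/matrixP=> i j; rewrite !mxE rmorph_prod mul1r mulrC -natrM.
  rewrite bin_ffact ffact_prod natr_prod big_mkord.
  by apply: eq_bigr => l _; apply: meval_fib_poly.
rewrite det_scale det_binomial big1 // mulr1 mul1r.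
by apply/prodf_neq0 => j _; rewrite pnatr_eq0 -lt0n fact_gt0.
Qed.

Theorem theorem17 (d : nat) (hd : (0 < d)%N) :
  (forall n k : nat, (k <= n)%N ->
     \det (\matrix_(i < d, j < d) fibonomial (n + i + j) j) != 0 /\
     \det (\matrix_(i < d, j < d) fibonomial (n + i + j) (k + j))
       / \det (\matrix_(i < d, j < d) fibonomial (n + i + j) j)
     = hoggatt d n k)
  /\
  (forall n k : nat,
     \det (\matrix_(i < d, j < d) fibonomial (n + i) j) != 0 /\
     \det (\matrix_(i < d, j < d) fibonomial (n + i + k) (k + j))
       / \det (\matrix_(i < d, j < d) fibonomial (n + i) j)
     = hoggatt d (n + k) k).
Proof.
(* Entrywise rescaling for the first identity: [x] is [fib_fact (n + i + j)], [a / b] the factor of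
   row [i], [c / e] that of column [j]. *)
have cancel_factors (K : fieldType) (a b c e x : K) : a != 0 -> b != 0 ->
    c != 0 -> e != 0 -> x / e / b = a / b * (c / e) * (x / c / a).
  by move=> a0 b0 c0 e0; field; rewrite a0 b0 c0 e0.
split=> [n k le_kn | n k].
  have D0 : \det (\matrix_(i < d, j < d) fibonomial (n + i + j) j) != 0.
    have := det_fibonomial_neq0 d (addn n); congr (\det _ != 0).
    by apply/matrixP=> i j; rewrite !mxE addnAC.
  split=> //; rewrite hoggattE //; apply: (canLR (mulfK D0)).
  rewrite -det_scale; congr (\det _); apply/matrixP=> i j; rewrite !mxE.
  rewrite !fibonomialE ?leq_addl ?leq_add2r ?(leq_trans le_kn) ?leq_addr //.
  rewrite addnK subnDr addnBAC //.
  by apply: cancel_factors; apply: fib_fact_neq0.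
have D0 := det_fibonomial_neq0 d (fun=> n).
split=> //; rewrite hoggattE ?leq_addl //; apply: (canLR (mulfK D0)).
rewrite -det_scale; congr (\det _); apply/matrixP=> i j; rewrite !mxE.
by rewrite fibonomial_add addnK addnAC.
Qed.
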